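(* Let $P$ be a finite poset and let $(P,\mathcal{I})$ be a po-independence system. Then the following statements are equivalent: (a) for every order-preserving weight function $w:P\rightarrow \mathbf{R}^+$, the algorithm PGREEDY is correct on input $(P,\mathcal{I})$, $w$; (b) $(P,\mathcal{I})$ is a poset matroid.
   Context: $\mathbf{R}^+$ denotes the set of nonnegative real numbers. An up-set of a poset $P$ is a subset $S\subseteq P$ such that $x\in S$ and $x\leq y$ imply $y\in S$. For $S\subseteq P$, $Max(S)$ denotes the set of maximal elements of $S$. A po-independence system is a pair $(P,\mathcal{I})$ where $P$ is a finite poset and $\mathcal{I}$ is a family of up-sets of $P$ such that: (i) if $X,Y$ are up-sets of $P$ with $Y\in\mathcal{I}$ and $X\subseteq Y$, then $X\in\mathcal{I}$. A poset matroid is a pair $(P,\mathcal{I})$ where $P$ is a finite poset and $\mathcal{I}$ is a nonempty family of up-sets of $P$ satisfying (i) and: (ii) for every $X,Y\in\mathcal{I}$ with $|X|<|Y|$, there exists $y\in Max(Y\setminus X)$ such that $X\cup\{y\}\in\mathcal{I}$. A function $w:P\rightarrow\mathbf{R}^+$ is order-preserving if $x\leq y$ implies $w(x)\leq w(y)$. For $M\subseteq P$, $w(M)=\sum_{x\in M}w(x)$. The algorithm PGREEDY on input $(P,\mathcal{I})$, $w$ is the following. Set $S:=\emptyset$ and $Q:=P$. While $Q\neq\emptyset$: choose a maximal element $m$ of $Q$ having maximum weight (among the maximal elements of $Q$; ties are broken arbitrarily); set $Q:=Q\setminus\{m\}$; if $S\cup\{m\}\in\mathcal{I}$, set $S:=S\cup\{m\}$.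 Finally return $S$. PGREEDY is correct on input $(P,\mathcal{I})$, $w$ if the returned set $S$ (however ties are broken) is an up-set belonging to $\mathcal{I}$ and $w(S)$ is maximum among all $w(M)$ with $M\in\mathcal{I}$. *)

(* Defs.v *)
From HB Require Import structures.
From mathcomp Require Import all_boot all_order all_algebra.
From mathcomp Require Import reals.

Set Implicit Arguments.
Unset Strict Implicit.
Unset Printing Implicit Defensive.

Import Order.TTheory GRing.Theory Num.Theory.

Section PosetFamilies.
Context {d : Order.disp_t} {P : finPOrderType d}.
Implicit Types (S X Y : {set P}) (I : {set {set P}}).

Definition up_set S : Prop :=
  forall x y : P, x \in S -> (x <= y)%O -> y \in S.

Definition Max S : {set P} := [set x in S | [forall y in S, ~~ (x < y)%O]].

Definition family_of_up_sets I : Prop := forall X, X \in I -> up_set X.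

Definition hereditary I : Prop :=
  forall X Y, up_set X -> up_set Y -> Y \in I -> X \subset Y -> X \in I.

Definition exchange I : Prop :=
  forall X Y, X \in I -> Y \in I -> #|X| < #|Y| ->
  exists2 y, y \in Max (Y :\: X) & X :|: [set y] \in I.

(* The empty family is allowed here, but not in [poset_matroid]. *)
Definition po_independence_system I : Prop :=
  family_of_up_sets I /\ hereditary I.

Definition poset_matroid I : Prop :=
  [/\ I != set0, family_of_up_sets I, hereditary I & exchange I].

End PosetFamilies.

Section PGreedy.
Context {d : Order.disp_t} {P : finPOrderType d} {R : realType}.
Implicit Types (S Q T M : {set P}) (I : {set {set P}}) (w : P -> R).

Local Open Scope ring_scope.

Definition order_preserving w : Prop :=
  forall x y : P, (x <= y)%O -> w x <= w y.

Definition weight w M : R := \sum_(x in M) w x.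

Definition greedy_choice w Q (m : P) : Prop :=
  m \in Max Q /\ forall m', m' \in Max Q -> w m' <= w m.

(* [pgreedy_run I w S Q T]: from the state (S, Q), the while loop can end
   with the value T.  This is a relation rather than a function because ties
   are broken arbitrarily; the loop guard Q != set0 is implied in
   [pgreedy_step] by m \in Max Q. *)
Inductive pgreedy_run I w : {set P} -> {set P} -> {set P} -> Prop :=
| pgreedy_stop S : pgreedy_run I w S set0 S
| pgreedy_step S Q T m :
    greedy_choice w Q m ->
    pgreedy_run I w (if S :|: [set m] \in I then S :|: [set m] else S)
                    (Q :\ m) T ->
    pgreedy_run I w S Q T.

Definition pgreedy_returns I w S : Prop := pgreedy_run I w set0 [set: P] S.

Definition pgreedy_correct I w : Prop :=
  forall S, pgreedy_returns I w S ->
  [/\ up_set S, S \in I & forall M, M \in I -> weight w M <= weight w S].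

End PGreedy.

(* Main.v *)
Require Import Defs.
From HB Require Import structures.
From mathcomp Require Import all_boot all_order all_algebra.
From mathcomp Require Import reals.

(** Both directions follow a state (S, Q) of the loop: S is the set built so
    far, Q the set of elements still to be examined, and the complement of Q,
    the set of elements already examined, is always an up-set because each
    examined element is maximal in Q.

    From a poset matroid to correctness.  Cutting a member of I down to the
    examined up-set leaves a member of I, so an element that was rejected
    could not be added later either: S stays maximal among the members of I
    made of examined elements, and by exchange it then has the largest
    cardinality among them ([card_le_saturated]).  Every element lies below a
    maximal one, so for an order-preserving weight the elements are examined
    by decreasing weight.  Hence, for any M in I, at every moment S has at
    least as many elements as the examined part of M, and summation by parts
    turns this into an inequality between weights ([dominates_step]).

    From correctness to exchange.  Suppose that X, Y in I with k = #|X| < #|Y|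
    violate exchange.  Give weight k + 2 to the elements of X, k + 1 to those
    of Y outside X, and 0 to the others; this is order-preserving because X
    and Y are up-sets.  The algorithm first accepts all of X, and then rejects
    all of Y outside X: an accepted element of this kind would be a maximal
    element of Y \ X that extends X ([no_exchange_reject]).  It returns a set
    of weight k (k + 2), which is less than (k + 1) ^ 2, hence less than the
    weight of Y. *)

Set Implicit Arguments.
Unset Strict Implicit.
Unset Printing Implicit Defensive.

Import Order.TTheory GRing.Theory Num.Theory.
Local Open Scope ring_scope.

(** * Up-sets, maximal elements and runs *)

Section UpSets.
Context {d : Order.disp_t} {P : finPOrderType d}.
Implicit Types (S Q X Y M : {set P}) (I : {set {set P}}).

Lemma up_set0 : up_set (set0 : {set P}).
Proof. by move=> x y; rewrite inE. Qed.

Lemma up_setI X Y : up_set X -> up_set Y -> up_set (X :&: Y).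
Proof.
move=> uX uY x y /setIP[xX xY] xy.
by rewrite inE (uX _ _ xX xy) (uY _ _ xY xy).
Qed.

Lemma up_setU X Y : up_set X -> up_set Y -> up_set (X :|: Y).
Proof.
move=> uX uY x y /setUP[xX|xY] xy; rewrite inE.
  by rewrite (uX _ _ xX xy).
by rewrite (uY _ _ xY xy) orbT.
Qed.

Lemma up_setC_setD1 Q m : up_set (~: Q) -> m \in Max Q -> up_set (~: (Q :\ m)).
Proof.
move=> uQ; rewrite inE => /andP[mQ /forall_inP mmax] x y.
rewrite !inE !negb_and !negbK => /orP[/eqP->|xQ] xy.
  have [//|ym] := eqVneq y m; apply/negP => yQ.
  by have := mmax y yQ; rewrite lt_neqAle xy eq_sym ym.
by have := uQ x y; rewrite !inE => ->//; rewrite orbT.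
Qed.

Lemma exists_Max_above Q q : q \in Q -> exists2 m, m \in Max Q & (q <= m)%O.
Proof.
move=> qQ.
have Pq : (q \in Q) && (q <= q)%O by rewrite qQ lexx.
(* Going strictly up strictly enlarges the principal down-set. *)
case: (@arg_maxnP _ q (fun x => (x \in Q) && (q <= x)%O)
  (fun x => #|[set z | (z <= x)%O]|) Pq) => m /andP[mQ qm] mmax.
exists m => //; rewrite inE mQ; apply/forall_inP => y yQ; apply/negP => my.
have := mmax y; rewrite yQ (le_trans qm (ltW my)) => /(_ isT).
rewrite /= leqNgt => /negP; apply; apply: proper_card; apply/properP; split.
  by apply/subsetP => z; rewrite !inE => /le_trans; apply; exact: ltW.
by exists y; rewrite !inE ?lexx// lt_geF.
Qed.

Lemma hereditary_setI I X Y :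
  family_of_up_sets I -> hereditary I -> up_set Y -> X \in I -> X :&: Y \in I.
Proof.
move=> fI hI uY XI; apply: (hI _ X) => //; last exact: subsetIl.
  by apply: up_setI => //; exact: fI.
exact: fI.
Qed.

End UpSets.

Section Runs.
Context {d : Order.disp_t} {P : finPOrderType d} {R : realType}.
Implicit Types (S Q T M : {set P}) (I : {set {set P}}) (w : P -> R).

Lemma pgreedy_run_invariant I w (J : {set P} -> {set P} -> Prop) :
  (forall S Q m, J S Q -> greedy_choice w Q m ->
     J (if S :|: [set m] \in I then S :|: [set m] else S) (Q :\ m)) ->
  forall S Q T, pgreedy_run I w S Q T -> J S Q -> J T set0.
Proof. by move=> Jstep S Q T; elim=> // {}S {}Q {}T m gm _ IH JSQ; auto. Qed.

Lemma greedy_choice_exists w Q : Q != set0 -> exists m, greedy_choice w Q m.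
Proof.
case/set0Pn => q /exists_Max_above[m0 m0Q _].
case: (arg_maxP w m0Q) => m mQ mmax.
by exists m; split=> // m' /mmax.
Qed.

Lemma pgreedy_run_exists I w S Q : exists T, pgreedy_run I w S Q T.
Proof.
have [n] := ubnP #|Q|; elim: n S Q => // n IH S Q.
have [->|/(greedy_choice_exists w)[m gm]] := eqVneq Q set0.
  by exists S; exact: pgreedy_stop.
have mQ : m \in Q by case: gm; rewrite inE => /andP[].
rewrite (cardsD1 m) mQ ltnS => /IH IHm.
have [T rT] := IHm (if S :|: [set m] \in I then S :|: [set m] else S).
by exists T; exact: pgreedy_step rT.
Qed.

(** A maximal element of Q of largest weight is heaviest in all of Q, as the
    weight cannot decrease on the way up to a maximal element. *)
Lemma greedy_choice_heaviest w Q m q :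
  order_preserving w -> greedy_choice w Q m -> q \in Q -> w q <= w m.
Proof.
move=> opw [_ mmax] /exists_Max_above[m' m'Q qm'].
exact: le_trans (opw _ _ qm') (mmax _ m'Q).
Qed.

End Runs.

(** * Poset matroids make the algorithm correct *)

Section MatroidCorrect.
Context {d : Order.disp_t} {P : finPOrderType d} {R : realType}.
Implicit Types (S Q T M : {set P}) (I : {set {set P}}) (w : P -> R).

Definition saturated I S Q : Prop :=
  [/\ up_set (~: Q), S \in I, S \subset ~: Q &
      forall y, y \notin Q -> y \notin S -> S :|: [set y] \notin I].

Lemma saturated_step I S Q m :
  family_of_up_sets I -> hereditary I -> saturated I S Q -> m \in Max Q ->
  saturated I (if S :|: [set m] \in I then S :|: [set m] else S) (Q :\ m).
Proof.
move=> fI hI [uQ SI /subsetP SQ Smax] mM.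
have uQm := up_setC_setD1 uQ mM.
have mQ : m \in Q by move: mM; rewrite inE => /andP[].
case: ifPn => [SmI|SmI]; split=> //.
- apply/subsetP => x /setUP[/SQ|/set1P->]; rewrite !inE ?eqxx//.
  by move/negPf->; rewrite andbF.
- move=> y; rewrite !inE negb_and negbK negb_or => /orP[->|yQ]; first by rewrite andbF.
  move=> /andP[yS ym]; apply/negP => SmyI.
  (* Dropping m from the enlarged set contradicts the earlier rejection of y. *)
  have /negP := Smax _ yQ yS; apply.
  suff -> : S :|: [set y] = (S :|: [set m] :|: [set y]) :&: ~: Q.
    exact: hereditary_setI.
  apply/setP => x; rewrite !inE.
  have [->|_] := eqVneq x m.
    have mS : m \in S = false by apply: contraTF mQ => /SQ; rewrite inE.
    by rewrite mQ andbF mS eq_sym (negPf ym).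
  have [->|_] := eqVneq x y; first by rewrite !orbT yQ.
  by rewrite !orbF; case xS : (x \in S) => //=; have := SQ _ xS; rewrite inE.
- apply/subsetP => x /SQ; rewrite !inE => /negPf->; by rewrite andbF.
- move=> y; rewrite !inE negb_and negbK => /orP[/eqP->//|]; exact: Smax.
Qed.

Lemma card_le_saturated I S Q M :
  poset_matroid I -> saturated I S Q -> M \in I -> (#|M :\: Q| <= #|S|)%N.
Proof.
move=> [_ fI hI eI] [uQ SI SQ Smax] MI; rewrite leqNgt; apply/negP => ltSM.
have MQI : M :\: Q \in I by rewrite setDE; exact: hereditary_setI.
have [y] := eI _ _ SI MQI ltSM.
by rewrite !inE => /andP[/and3P[yS yQ _] _]; apply/negP; exact: Smax.
Qed.

(** Summation by parts in incremental form: subtracting a threshold c below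
    all examined weights makes the newest element contribute 0 when c is its
    own weight, and lets c decrease afterwards thanks to the comparison of
    cardinalities. The value c = 0 gives the comparison of weights. *)
Definition dominates w M S Q : Prop :=
  forall c, (forall u, u \notin Q -> c <= w u) ->
  \sum_(x in M :\: Q) (w x - c) <= \sum_(x in S) (w x - c).

Lemma sum_threshold w (A : {set P}) b c :
  \sum_(x in A) (w x - c) = \sum_(x in A) (w x - b) + (b - c) *+ #|A|.
Proof.
rewrite -sumr_const -big_split /=; apply: eq_bigr => x _.
by rewrite addrA subrK.
Qed.

Lemma dominates_step w M S S' Q m :
  (forall u, u \notin Q -> w m <= w u) -> m \in Q -> m \notin S ->
  S' = S \/ S' = S :|: [set m] ->
  (#|M :\: (Q :\ m)| <= #|S'|)%N ->
  dominates w M S Q -> dominates w M S' (Q :\ m).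
Proof.
move=> mlow mQ mS S'E card_le dom c cle.
have cm : c <= w m by apply: cle; rewrite !inE eqxx.
rewrite (sum_threshold _ _ (w m)) (sum_threshold w S' (w m)).
apply: lerD; last by apply: ler_wpMn2l; rewrite ?subr_ge0.
have -> : \sum_(x in S') (w x - w m) = \sum_(x in S) (w x - w m).
  case: S'E => -> //; rewrite setUC big_setU1 //=.
  by rewrite subrr add0r.
apply: le_trans (dom _ mlow).
rewrite (bigID (fun x => x == m)) /= big1 ?add0r; last first.
  by move=> x /andP[_ /eqP->]; rewrite subrr.
rewrite le_eqVlt; apply/orP; left; apply/eqP; apply: eq_bigl => x.
by rewrite !inE; case: (eqVneq x m) => [->|]; rewrite ?mQ ?andbF ?andbT.
Qed.

Lemma poset_matroid_pgreedy_correct I w :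
  (forall x, 0 <= w x) -> order_preserving w -> poset_matroid I ->
  pgreedy_correct I w.
Proof.
move=> w0 opw mI S runS; have [Ine fI hI _] := mI.
pose J S Q := [/\ saturated I S Q,
  (forall u q, u \notin Q -> q \in Q -> w q <= w u) &
  (forall M, M \in I -> dominates w M S Q)].
have: J S set0.
  apply: pgreedy_run_invariant runS _.
    move=> {}S Q m [sat dec dom] gm; have mM := gm.1.
    have sat' := saturated_step fI hI sat mM.
    have mQ : m \in Q by move: mM; rewrite inE => /andP[].
    have mS : m \notin S.
      by case: sat => _ _ /subsetP SQ _; apply: contraL mQ => /SQ; rewrite inE.
    split=> // [u q|M MI].
      rewrite !inE negb_and negbK => /orP[/eqP->|uQ] /andP[_ qQ].
        exact: greedy_choice_heaviest gm qQ.
      exact: dec.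
    apply: (@dominates_step w M S _ Q m) => //.
    - by move=> u uQ; exact: dec.
    - by case: ifP; [right|left].
    - exact: card_le_saturated sat' MI.
    - exact: dom.
  split=> [|u q|M MI c _].
  - split; last by move=> y; rewrite inE.
    + by rewrite setCT; exact: up_set0.
    + case/set0Pn: Ine => X XI; rewrite -(setI0 X).
      by apply: hereditary_setI => //; exact: up_set0.
    + exact: sub0set.
  - by rewrite inE.
  - by rewrite setDT.
case=> -[_ SI _ _] _ dom; split=> //; first exact: fI.
move=> M MI; have := dom M MI 0 (fun u _ => w0 u).
by rewrite setD0 /weight; under eq_bigr do rewrite subr0;
   under [leRHS]eq_bigr do rewrite subr0.
Qed.

End MatroidCorrect.

(** * Correctness forces the exchange property *)

Section CorrectMatroid.
Context {d : Order.disp_t} {P : finPOrderType d} {R : realType}.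
Implicit Types (S Q T X Y M : {set P}) (I : {set {set P}}).

Definition two_level_weight X Y (x : P) : nat :=
  if x \in X then #|X|.+2 else if x \in Y then #|X|.+1 else 0%N.

Lemma two_level_weight_homo X Y x y :
  up_set X -> up_set Y -> (x <= y)%O ->
  (two_level_weight X Y x <= two_level_weight X Y y)%N.
Proof.
move=> uX uY xy; rewrite /two_level_weight.
case: ifPn => [xX|_]; first by rewrite (uX _ _ xX xy).
case: ifPn => [xY|//]; rewrite (uY _ _ xY xy).
by case: ifP.
Qed.

(** If S + m is in I, then so is its trace X + m on the union of X and Y,
    and anything of Y strictly above m lies in S, hence in X; so m would be a
    maximal element of Y \ X that extends X. *)
Lemma no_exchange_reject I X Y S m :
  family_of_up_sets I -> hereditary I -> up_set X -> up_set Y ->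
  (forall y, y \in Max (Y :\: X) -> X :|: [set y] \notin I) ->
  X \subset S -> S :&: Y \subset X -> m \in Y :\: X -> S :|: [set m] \notin I.
Proof.
move=> fI hI uX uY noex /subsetP XS /subsetP SY mYX; apply/negP => SmI.
have /setDP[mY mX] := mYX.
have mMax : m \in Max (Y :\: X).
  rewrite inE mYX; apply/forall_inP => y /setDP[yY yX]; apply/negP => my.
  have /(_ m y) := fI _ SmI; rewrite !inE eqxx orbT => /(_ isT (ltW my)).
  rewrite [y == m]gt_eqF// orbF => yS.
  by case/negP: yX; apply: SY; rewrite inE yS.
have /negP := noex m mMax; apply.
suff -> : X :|: [set m] = (S :|: [set m]) :&: (X :|: Y).
  by apply: hereditary_setI => //; exact: up_setU.
apply/setP => x; rewrite !inE.
have [->|_] := eqVneq x m; first by rewrite mY !orbT.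
rewrite !orbF; case xX : (x \in X); first by rewrite XS.
by apply/esym/negbTE/negP => xSY; move: (SY x); rewrite inE xX => /(_ xSY).
Qed.

(** The first alternative describes the phase in which X is being examined
    and accepted, the second one the phase after it. *)
Lemma pgreedy_no_exchange I X Y T (w := fun x => (two_level_weight X Y x)%:R : R) :
  family_of_up_sets I -> hereditary I -> X \in I -> up_set Y ->
  (forall y, y \in Max (Y :\: X) -> X :|: [set y] \notin I) ->
  pgreedy_returns I w T -> T :&: Y \subset X.
Proof.
move=> fI hI XI uY noex runT.
have uX : up_set X by exact: fI.
pose J S Q := up_set (~: Q) /\ (S = X :\: Q \/ X \subset S /\ S :&: Y \subset X).
suff: J T set0.
  by case=> _ [->|[]//]; rewrite setD0; exact: subsetIl.
apply: pgreedy_run_invariant runT _; last first.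
  by rewrite /J setCT setDT; split; [exact: up_set0 | left].
move=> S Q m [uQ JS] gm; have mM := gm.1.
have uQm := up_setC_setD1 uQ mM; split=> //.
have [XQ0|/set0Pn[q /setIP[qX qQ]]] := eqVneq (X :&: Q) set0.
  have [XS SY] : X \subset S /\ S :&: Y \subset X.
    case: JS => // ->; split.
      by rewrite subsetD subxx -setI_eq0 XQ0 eqxx.
    by apply: subset_trans (subsetIl _ _) _; exact: subsetDl.
  right; case: ifP => [SmI|//]; split.
    by apply: subset_trans XS _; exact: subsetUl.
  apply/subsetP => x; rewrite !inE => /andP[/orP[xS|/eqP->] xY].
    by apply: (subsetP SY); rewrite inE xS.
  apply: contraTT SmI => mX; apply: (no_exchange_reject fI hI uX uY noex XS SY).
  by rewrite inE mX.
have mX : m \in X.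
  (* Some maximal element of Q is in X, and only X has the largest weight. *)
  have [m' m'M qm'] := exists_Max_above qQ.
  have m'X : m' \in X by exact: uX qm'.
  have := gm.2 _ m'M; rewrite ler_nat /two_level_weight m'X.
  by case: ifP => //; case: ifP; rewrite ?ltnn.
case: JS => [SE|[XS SY]]; last first.
  right; suff -> : S :|: [set m] = S by case: ifP.
  by apply/setUidPl; rewrite sub1set (subsetP XS).
left; have mQ : m \in Q by move: mM; rewrite inE => /andP[].
have -> : S :|: [set m] = X :\: (Q :\ m).
  rewrite SE; apply/setP => x; rewrite !inE.
  by have [->|_] := eqVneq x m; rewrite ?mX ?orbT ?orbF.
by rewrite setDE hereditary_setI.
Qed.

Lemma pgreedy_correct_exchange I :
  po_independence_system I ->
  (forall w : P -> R, (forall x : P, 0 <= w x) -> order_preserving w ->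
     pgreedy_correct I w) ->
  exchange I.
Proof.
move=> [fI hI] corr X Y XI YI ltXY.
have uX := fI _ XI; have uY := fI _ YI.
case: (boolP [exists y in Max (Y :\: X), X :|: [set y] \in I]) => [/exists_inP//|].
move=> /exists_inPn noex.
pose w x := (two_level_weight X Y x)%:R : R.
have [T runT] := pgreedy_run_exists I w set0 [set: P].
have /subsetP TY := pgreedy_no_exchange fI hI XI uY noex runT.
have [||_ _ /(_ _ YI)] := corr w _ _ T runT.
- by move=> x; exact: ler0n.
- by move=> x y xy; rewrite ler_nat; exact: two_level_weight_homo.
rewrite /weight -!natr_sum ler_nat => YT; exfalso.
have leT : (\sum_(x in T) two_level_weight X Y x <= #|X| * #|X|.+2)%N.
  rewrite -sum_nat_const (bigID (mem X)) /= [X in (_ + X)%N]big1 ?addn0.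
    rewrite [leqRHS](bigID (mem T)) /= (eq_bigl _ _ (fun x => andbC _ _)).
    apply: leq_trans (leq_addr _ _); apply: leq_sum => x /andP[xX _].
    by rewrite /two_level_weight xX.
  move=> x /andP[xT xX]; rewrite /two_level_weight (negPf xX).
  by case: ifP => // xY; case/negP: xX; apply: TY; rewrite inE xT.
have geY : (#|Y| * #|X|.+1 <= \sum_(x in Y) two_level_weight X Y x)%N.
  rewrite -sum_nat_const; apply: leq_sum => x xY.
  by rewrite /two_level_weight xY; case: ifP.
have := leq_trans (leq_trans geY YT) leT.
rewrite leqNgt => /negP; apply; apply: leq_trans (leq_mul ltXY (leqnn _)).
by rewrite mulnS [ltnRHS]mulSn ltn_add2r.
Qed.

End CorrectMatroid.

Theorem theorem2p1 (R : realType) (d : Order.disp_t) (P : finPOrderType d)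
    (I : {set {set P}}) (hI : po_independence_system I) :
  (forall w : P -> R, (forall x : P, 0 <= w x) -> order_preserving w ->
     pgreedy_correct I w)
  <-> poset_matroid I.
Proof.
split=> [corr|mI w w0 opw]; last exact: poset_matroid_pgreedy_correct.
split; [|exact: hI.1|exact: hI.2|exact: pgreedy_correct_exchange corr].
have [S runS] := pgreedy_run_exists I (fun=> 0 : R) set0 [set: P].
have [//|//|_ SI _] := corr (fun=> 0) _ _ S runS.
by apply/set0Pn; exists S.
Qed.
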